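(* Let $t\to_{\mathsf G}^{*} s$ and let $v$ be a bad value of $s$, i.e. $s=C\langle v\rangle$ with $v$ a value occurring as a subterm at that position and $C$ a bad context. Then $|v|\le|t|$.
   Context: Exponential substitution calculus. Variables: multiplicative $m,n,o,\ldots$ and exponential $e,f,g,\ldots$ (disjoint kinds); $x,y,z$ range over both. Multiplicative values $v_{\mathsf m} ::= m \mid (t,s) \mid \lambda x.t$; exponential values $v_{\mathsf e} ::= e \mid\ !t$; values $v ::= v_{\mathsf m}\mid v_{\mathsf e}$. Terms: $t,s,u ::= v \mid \mathsf{cut}(v,x.t) \mid \mathsf{par}(m,x.y.t) \mid \mathsf{sub}(m,v,x.t) \mid \mathsf{der}(e,x.t)$; in $\lambda x.t$, cut, sub, der $x$ is bound in $t$, in par $x,y$ are bound; terms up to $\alpha$; $\mathrm{fv}$ = free variables; $|t|$ = size of $t$ (number of constructor occurrences). Left contexts $L ::= \langle\cdot\rangle \mid \mathsf{cut}(v,x.L)\mid\mathsf{par}(m,x.y.L)\mid\mathsf{sub}(m,v,x.L)\mid\mathsf{der}(e,x.L)$; every term is uniquely $L\langle v\rangle$. Value contexts $V ::= \langle\cdot\rangle \mid (C,s)\mid (t,C)\mid\lambda x.C\mid\ !C$; general contexts $C ::= V \mid \mathsf{cut}(V,x.t)\mid\mathsf{sub}(m,V,x.t)\mid L\langle C\rangle$; multiplicative value contexts $V_{\mathsf m} ::= \langle\cdot\rangle\mid (M,s)\mid(t,M)\mid\lambda x.M$; multiplicative contexts $M ::= V_{\mathsf m}\mid \mathsf{cut}(V_{\mathsf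 m},x.t)\mid \mathsf{sub}(m,V_{\mathsf m},x.t)\mid L\langle M\rangle$. Plugging $C\langle t\rangle$ replaces the hole (may capture), except that if $t=L\langle v\rangle$ then $\mathsf{cut}(\langle\cdot\rangle,x.s)\langle t\rangle := L\langle\mathsf{cut}(v,x.s)\rangle$ and $\mathsf{sub}(m,\langle\cdot\rangle,x.s)\langle t\rangle := L\langle\mathsf{sub}(m,v,x.s)\rangle$; $C\langle\!\langle t\rangle\!\rangle$ is capture-avoiding plugging. For multiplicative $m,n$, $\{n/m\}t$ is renaming. Micro-step root rules (context does not capture the cut variable): (ax$_{m1}$) $\mathsf{cut}(v_{\mathsf m},m.M\langle\!\langle m\rangle\!\rangle)\mapsto M\langle\!\langle v_{\mathsf m}\rangle\!\rangle$; (ax$_{m2}$) $\mathsf{cut}(n,m.t)\mapsto \{n/m\}t$; ($\otimes$) $\mathsf{cut}((s,u),m.M\langle\mathsf{par}(m,x.y.t)\rangle)\mapsto M\langle L\langle\mathsf{cut}(v,x.L'\langle\mathsf{cut}(v',y.t)\rangle)\rangle\rangle$ where $s=L\langle v\rangle$, $u=L'\langle v'\rangle$; ($\multimap$) $\mathsf{cut}(\lambda y.s,m.M\langle\mathsf{sub}(m,v,x.t)\rangle)\mapsto M\langle\mathsf{cut}(v,y.L\langle\mathsf{cut}(v',x.t)\rangle)\rangle$ where $s=L\langle v'\rangle$; (ax$_{e1}$) $\mathsf{cut}(v_{\mathsf e},e.C\langle\!\langle e\rangle\!\rangle)\mapsto\mathsf{cut}(v_{\mathsf e},e.C\langle\!\langle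 v_{\mathsf e}\rangle\!\rangle)$; (ax$_{e2}$) $\mathsf{cut}(f,e.C\langle\mathsf{der}(e,x.t)\rangle)\mapsto\mathsf{cut}(f,e.C\langle\mathsf{der}(f,x.t)\rangle)$; (!der) $\mathsf{cut}(!s,e.C\langle\mathsf{der}(e,x.t)\rangle)\mapsto\mathsf{cut}(!s,e.C\langle L\langle\mathsf{cut}(v,x.t)\rangle\rangle)$ where $s=L\langle v\rangle$; (w) $\mathsf{cut}(v_{\mathsf e},e.t)\mapsto t$ if $e\notin\mathrm{fv}(t)$. $\to_{\mathrm{ms}}$ is the union of their closures under general contexts. Positions of redexes: every non-(w) step reduces a term $t=C\langle\mathsf{cut}(v,x.D\langle t_x\rangle)\rangle$ where the fired cut is the one on $x$ and $t_x$ is the occurrence of $x$ it acts on (a subterm of form $x$, $\mathsf{par}(x,\ldots)$, $\mathsf{sub}(x,\ldots)$ or $\mathsf{der}(x,\ldots)$); its position is $C\langle\mathsf{cut}(v,x.D)\rangle$. A (w) step $C\langle t\rangle\to C\langle s\rangle$ with $t\mapsto_w s$ has position $C$. In positions, the plugged term is an actual subterm. Dominating free variables $\mathrm{dfv}(C)$: $\mathrm{dfv}(\langle\cdot\rangle)=\emptyset$; $\mathrm{dfv}((C,v))=\mathrm{dfv}((v,C))=\mathrm{dfv}(!C)=\mathrm{dfv}(C)$; $\mathrm{dfv}(\lambda x.C)=\mathrm{dfv}(C)\setminus\{x\}$; $\mathrm{dfv}(\mathsf{cut}(v,x.C))=\mathrm{dfv}(C)\setminus\{x\}$; $\mathrm{dfv}(\mathsf{cut}(V,x.t))=\mathrm{dfv}(V)$;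 $\mathrm{dfv}(\mathsf{par}(m,x.y.C))=\{m\}\cup(\mathrm{dfv}(C)\setminus\{x,y\})$ if $x\in\mathrm{dfv}(C)$ or $y\in\mathrm{dfv}(C)$, else $\mathrm{dfv}(C)$; $\mathrm{dfv}(\mathsf{sub}(m,V,x.t))=\{m\}\cup\mathrm{dfv}(V)$; $\mathrm{dfv}(\mathsf{sub}(m,v,x.C))=\{m\}\cup(\mathrm{dfv}(C)\setminus\{x\})$ if $x\in\mathrm{dfv}(C)$, else $\mathrm{dfv}(C)$; $\mathrm{dfv}(\mathsf{der}(e,x.C))=\{e\}\cup(\mathrm{dfv}(C)\setminus\{x\})$ if $x\in\mathrm{dfv}(C)$, else $\mathrm{dfv}(C)$. Good value contexts $V_G ::= \langle\cdot\rangle\mid(G,t)\mid(t,G)\mid\lambda x.G\mid\ !G$; good contexts $G ::= V_G\mid\mathsf{par}(m,x.y.G)\mid\mathsf{sub}(m,v,x.G)\mid\mathsf{sub}(m,V_G,x.t)\mid\mathsf{der}(e,x.G)\mid\mathsf{cut}(v,x.G)$ provided $x\notin\mathrm{dfv}(G)$. A bad context is a context that is not good. A $\to_{\mathrm{ms}}$ step is good, written $\to_{\mathsf G}$, if its position is a good context. *)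

(* Defs.v *)
From mathcomp Require Import all_boot.
From Stdlib Require Import Relation_Operators.

Set Implicit Arguments.
Unset Strict Implicit.
Unset Printing Implicit Defensive.

(* Raw named syntax; alpha-equivalence is [aeq] below. *)

(* The two disjoint kinds of variables: [mv i] is multiplicative and [ev i]
   is exponential. Constructors whose variable has a fixed kind store only
   the index [i]. *)
Notation var := (nat + nat)%type.
Notation mv := (@inl nat nat).
Notation ev := (@inr nat nat).

Definition is_mult (x : var) : bool := if x is inl _ then true else false.

Inductive term : Type :=
  | Val (v : value)
  | Cut (v : value) (x : var) (t : term)
  | Par (m : nat) (x y : var) (t : term)
  | Sub (m : nat) (v : value) (x : var) (t : term)
  | Der (e : nat) (x : var) (t : term)
with value : Type :=
  | Var (x : var)
  | Pair (t s : term)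
  | Lam (x : var) (t : term)
  | Bang (t : term).

Definition mult_value (v : value) : bool :=
  match v with Var x => is_mult x | Pair _ _ | Lam _ _ => true | Bang _ => false end.

Definition exp_value (v : value) : bool := ~~ mult_value v.

Definition is_val (t : term) : bool := if t is Val _ then true else false.

Fixpoint term_size (t : term) : nat :=
  match t with
  | Val v => value_size v
  | Cut v _ t => (value_size v + term_size t).+1
  | Par _ _ _ t => (term_size t).+1
  | Sub _ v _ t => (value_size v + term_size t).+1
  | Der _ _ t => (term_size t).+1
  end
with value_size (v : value) : nat :=
  match v with
  | Var _ => 1
  | Pair t s => (term_size t + term_size s).+1
  | Lam _ t => (term_size t).+1
  | Bang t => (term_size t).+1
  end.

Definition without (x : var) (A : seq var) : seq var := [seq z <- A | z != x].

Fixpoint fv (t : term) : seq var :=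
  match t with
  | Val v => vfv v
  | Cut v x t => vfv v ++ without x (fv t)
  | Par m x y t => mv m :: without x (without y (fv t))
  | Sub m v x t => mv m :: vfv v ++ without x (fv t)
  | Der e x t => ev e :: without x (fv t)
  end
with vfv (v : value) : seq var :=
  match v with
  | Var x => [:: x]
  | Pair t s => fv t ++ fv s
  | Lam x t => without x (fv t)
  | Bang t => fv t
  end.

(* All binding occurrences, with repetitions. *)
Fixpoint bv (t : term) : seq var :=
  match t with
  | Val v => vbv v
  | Cut v x t => vbv v ++ x :: bv t
  | Par _ x y t => x :: y :: bv t
  | Sub _ v x t => vbv v ++ x :: bv t
  | Der _ x t => x :: bv t
  end
with vbv (v : value) : seq var :=
  match v with
  | Var _ => [::]
  | Pair t s => bv t ++ bv s
  | Lam x t => x :: bv t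
  | Bang t => bv t
  end.

(* Barendregt's convention: bound names are pairwise distinct and distinct
   from the free ones. *)
Definition barendregt (t : term) : bool :=
  uniq (bv t) && ~~ has (mem (fv t)) (bv t).

(* Alpha-equivalence, relative to a list of pairs of matching binders with the
   innermost binder first. *)
Fixpoint aeq_var (env : seq (var * var)) (x y : var) : bool :=
  if env is (a, b) :: env'
  then if (x == a) || (y == b) then (x == a) && (y == b) else aeq_var env' x y
  else x == y.

Definition same_kind (x y : var) : bool := is_mult x == is_mult y.

Fixpoint aeq_in (env : seq (var * var)) (t t' : term) : bool :=
  match t, t' with
  | Val v, Val v' => vaeq_in env v v'
  | Cut v x t, Cut v' x' t' =>
      [&& vaeq_in env v v', same_kind x x' & aeq_in ((x, x') :: env) t t']
  | Par m x y t, Par m' x' y' t' =>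
      [&& aeq_var env (mv m) (mv m'), same_kind x x', same_kind y y'
        & aeq_in [:: (y, y'), (x, x') & env] t t']
  | Sub m v x t, Sub m' v' x' t' =>
      [&& aeq_var env (mv m) (mv m'), vaeq_in env v v', same_kind x x'
        & aeq_in ((x, x') :: env) t t']
  | Der e x t, Der e' x' t' =>
      [&& aeq_var env (ev e) (ev e'), same_kind x x'
        & aeq_in ((x, x') :: env) t t']
  | _, _ => false
  end
with vaeq_in (env : seq (var * var)) (v v' : value) : bool :=
  match v, v' with
  | Var x, Var x' => aeq_var env x x'
  | Pair t s, Pair t' s' => aeq_in env t t' && aeq_in env s s'
  | Lam x t, Lam x' t' => same_kind x x' && aeq_in ((x, x') :: env) t t'
  | Bang t, Bang t' => aeq_in env t t'
  | _, _ => false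
  end.

Definition aeq (t t' : term) : bool := aeq_in [::] t t'.

(* [rename n m t] replaces the free occurrences of the multiplicative variable
   m by n; it is capture-avoiding when n is not bound in t, which is the case
   under Barendregt's convention. *)
Definition rename_name (n m k : nat) : nat := if k == m then n else k.

Definition rename_var (n m : nat) (x : var) : var :=
  if x == mv m then mv n else x.

Fixpoint rename (n m : nat) (t : term) : term :=
  match t with
  | Val v => Val (vrename n m v)
  | Cut v x t => Cut (vrename n m v) x (if x == mv m then t else rename n m t)
  | Par k x y t =>
      Par (rename_name n m k) x y
          (if (x == mv m) || (y == mv m) then t else rename n m t)
  | Sub k v x t =>
      Sub (rename_name n m k) (vrename n m v) x
          (if x == mv m then t else rename n m t)
  | Der e x t => Der e x (if x == mv m then t else rename n m t)
  end
with vrename (n m : nat) (v : value) : value :=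
  match v with
  | Var x => Var (rename_var n m x)
  | Pair t s => Pair (rename n m t) (rename n m s)
  | Lam x t => Lam x (if x == mv m then t else rename n m t)
  | Bang t => Bang (rename n m t)
  end.

Inductive lctx : Type :=
  | LHole
  | LCut (v : value) (x : var) (L : lctx)
  | LPar (m : nat) (x y : var) (L : lctx)
  | LSub (m : nat) (v : value) (x : var) (L : lctx)
  | LDer (e : nat) (x : var) (L : lctx).

Fixpoint lplug (L : lctx) (t : term) : term :=
  match L with
  | LHole => t
  | LCut v x L => Cut v x (lplug L t)
  | LPar m x y L => Par m x y (lplug L t)
  | LSub m v x L => Sub m v x (lplug L t)
  | LDer e x L => Der e x (lplug L t)
  end.

(* Pre-contexts. The hole is inside the value argument in [CCutV] and [CSubV],
   inside the body in [CCut] and [CSub]. The grammars of contexts are the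
   predicates [vctx], [gctx], [mvctx], [mctx] and [good] below. *)
Inductive ctx : Type :=
  | CHole
  | CPairL (C : ctx) (s : term)
  | CPairR (t : term) (C : ctx)
  | CLam (x : var) (C : ctx)
  | CBang (C : ctx)
  | CCutV (C : ctx) (x : var) (t : term)
  | CSubV (m : nat) (C : ctx) (x : var) (t : term)
  | CCut (v : value) (x : var) (C : ctx)
  | CPar (m : nat) (x y : var) (C : ctx)
  | CSub (m : nat) (v : value) (x : var) (C : ctx)
  | CDer (e : nat) (x : var) (C : ctx).

Fixpoint lcomp (L : lctx) (C : ctx) : ctx :=
  match L with
  | LHole => C
  | LCut v x L => CCut v x (lcomp L C)
  | LPar m x y L => CPar m x y (lcomp L C)
  | LSub m v x L => CSub m v x (lcomp L C)
  | LDer e x L => CDer e x (lcomp L C)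
  end.

Inductive vctx : ctx -> Prop :=
  | vctx_hole : vctx CHole
  | vctx_pairl C s : gctx C -> vctx (CPairL C s)
  | vctx_pairr t C : gctx C -> vctx (CPairR t C)
  | vctx_lam x C : gctx C -> vctx (CLam x C)
  | vctx_bang C : gctx C -> vctx (CBang C)
with gctx : ctx -> Prop :=
  | gctx_v V : vctx V -> gctx V
  | gctx_cut V x t : vctx V -> gctx (CCutV V x t)
  | gctx_sub m V x t : vctx V -> gctx (CSubV m V x t)
  | gctx_left L C : gctx C -> gctx (lcomp L C).

Inductive mvctx : ctx -> Prop :=
  | mvctx_hole : mvctx CHole
  | mvctx_pairl M s : mctx M -> mvctx (CPairL M s)
  | mvctx_pairr t M : mctx M -> mvctx (CPairR t M)
  | mvctx_lam x M : mctx M -> mvctx (CLam x M)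
with mctx : ctx -> Prop :=
  | mctx_v V : mvctx V -> mctx V
  | mctx_cut V x t : mvctx V -> mctx (CCutV V x t)
  | mctx_sub m V x t : mvctx V -> mctx (CSubV m V x t)
  | mctx_left L M : mctx M -> mctx (lcomp L M).

(* [lmap f L<v>] is [L<f v>], for the unique decomposition of a term into a
   left context and a value. *)
Fixpoint lmap (f : value -> term) (t : term) : term :=
  match t with
  | Val v => f v
  | Cut v x t => Cut v x (lmap f t)
  | Par m x y t => Par m x y (lmap f t)
  | Sub m v x t => Sub m v x (lmap f t)
  | Der e x t => Der e x (lmap f t)
  end.

(* Possibly capturing plugging. In the [CCutV] and [CSubV] cases, [lmap]
   performs the extrusion of the left context of the plugged term when the
   hole is itself the value argument; when C is a non-hole value context,
   [plug C t] is a value and no extrusion takes place. *)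
Fixpoint plug (C : ctx) (t : term) : term :=
  match C with
  | CHole => t
  | CPairL C s => Val (Pair (plug C t) s)
  | CPairR u C => Val (Pair u (plug C t))
  | CLam x C => Val (Lam x (plug C t))
  | CBang C => Val (Bang (plug C t))
  | CCutV C x s => lmap (fun v => Cut v x s) (plug C t)
  | CSubV m C x s => lmap (fun v => Sub m v x s) (plug C t)
  | CCut v x C => Cut v x (plug C t)
  | CPar m x y C => Par m x y (plug C t)
  | CSub m v x C => Sub m v x (plug C t)
  | CDer e x C => Der e x (plug C t)
  end.

Fixpoint comp (C D : ctx) : ctx :=
  match C with
  | CHole => D
  | CPairL C s => CPairL (comp C D) s
  | CPairR u C => CPairR u (comp C D)
  | CLam x C => CLam x (comp C D)
  | CBang C => CBang (comp C D)
  | CCutV C x s => CCutV (comp C D) x s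
  | CSubV m C x s => CSubV m (comp C D) x s
  | CCut v x C => CCut v x (comp C D)
  | CPar m x y C => CPar m x y (comp C D)
  | CSub m v x C => CSub m v x (comp C D)
  | CDer e x C => CDer e x (comp C D)
  end.

(* The variables bound at the hole. *)
Fixpoint hole_bv (C : ctx) : seq var :=
  match C with
  | CHole => [::]
  | CPairL C _ | CPairR _ C | CBang C | CCutV C _ _ | CSubV _ C _ _ => hole_bv C
  | CLam x C | CCut _ x C | CSub _ _ x C | CDer _ x C => x :: hole_bv C
  | CPar _ x y C => [:: x, y & hole_bv C]
  end.

Definition no_capture (C : ctx) (v : value) : bool :=
  ~~ has (mem (vfv v)) (hole_bv C).

(* The hole is itself the value argument of a cut or a sub. *)
Fixpoint value_hole (C : ctx) : bool :=
  match C with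
  | CHole => false
  | CCutV CHole _ _ | CSubV _ CHole _ _ => true
  | CPairL C _ | CPairR _ C | CLam _ C | CBang C | CCutV C _ _ | CSubV _ C _ _
  | CCut _ _ C | CPar _ _ _ C | CSub _ _ _ C | CDer _ _ C => value_hole C
  end.

(* t is an actual subterm of [plug C t], that is, plugging t in C does not
   trigger extrusion. *)
Definition actual (C : ctx) (t : term) : bool := value_hole C ==> is_val t.

(* The terms that are themselves an occurrence of x. *)
Definition occ_of (x : var) (t : term) : bool :=
  match t with
  | Val (Var y) => y == x
  | Par m _ _ _ | Sub m _ _ _ => mv m == x
  | Der e _ _ => ev e == x
  | _ => false
  end.

(* [root P t s] : t rewrites to s by a root rule, with position P. *)
Inductive root : ctx -> term -> term -> Prop :=
  | root_axm1 v m M :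
      mult_value v -> mctx M -> mv m \notin hole_bv M -> no_capture M v ->
      root (CCut v (mv m) M)
           (Cut v (mv m) (plug M (Val (Var (mv m)))))
           (plug M (Val v))
  (* The only rule not presented through an occurrence: its positions are
     given by the occurrences of m in t. *)
  | root_axm2 n m t D tx :
      gctx D -> mv m \notin hole_bv D -> occ_of (mv m) tx -> actual D tx ->
      t = plug D tx ->
      root (CCut (Var (mv n)) (mv m) D)
           (Cut (Var (mv n)) (mv m) t)
           (rename n m t)
  | root_tensor s u L v L' v' m M x y t :
      mctx M -> mv m \notin hole_bv M -> actual M (Par m x y t) ->
      s = lplug L (Val v) -> u = lplug L' (Val v') ->
      root (CCut (Pair s u) (mv m) M)
           (Cut (Pair s u) (mv m) (plug M (Par m x y t)))
           (plug M (lplug L (Cut v x (lplug L' (Cut v' y t)))))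
  | root_lolli y s L v' m M v x t :
      mctx M -> mv m \notin hole_bv M -> actual M (Sub m v x t) ->
      s = lplug L (Val v') ->
      root (CCut (Lam y s) (mv m) M)
           (Cut (Lam y s) (mv m) (plug M (Sub m v x t)))
           (plug M (Cut v y (lplug L (Cut v' x t))))
  | root_axe1 v e C :
      exp_value v -> gctx C -> ev e \notin hole_bv C -> no_capture C v ->
      root (CCut v (ev e) C)
           (Cut v (ev e) (plug C (Val (Var (ev e)))))
           (Cut v (ev e) (plug C (Val v)))
  | root_axe2 f e C x t :
      gctx C -> ev e \notin hole_bv C -> actual C (Der e x t) ->
      root (CCut (Var (ev f)) (ev e) C)
           (Cut (Var (ev f)) (ev e) (plug C (Der e x t)))
           (Cut (Var (ev f)) (ev e) (plug C (Der f x t)))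
  | root_bang_der s L v e C x t :
      gctx C -> ev e \notin hole_bv C -> actual C (Der e x t) ->
      s = lplug L (Val v) ->
      root (CCut (Bang s) (ev e) C)
           (Cut (Bang s) (ev e) (plug C (Der e x t)))
           (Cut (Bang s) (ev e) (plug C (lplug L (Cut v x t))))
  | root_w v e t :
      exp_value v -> ev e \notin fv t ->
      root CHole (Cut v (ev e) t) t.

(* A micro step with position P, up to alpha. The name-sensitive root rules are
   applied to a representative that satisfies Barendregt's convention.
   Requiring r (and, in [root], the occurrence of the cut variable) to be an
   actual subterm loses no step: when plugging extrudes, the extruded cut is
   itself a redex of the same rule, with the same reduct. *)
Inductive ms_step (P : ctx) (t s : term) : Prop :=
  MsStep C R r r' of
    gctx C & root R r r' & actual C r & P = comp C R &
    aeq t (plug C r) & barendregt (plug C r) & aeq (plug C r') s.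

Fixpoint dfv (C : ctx) : seq var :=
  match C with
  | CHole => [::]
  | CPairL C _ | CPairR _ C | CBang C => dfv C
  | CLam x C => without x (dfv C)
  | CCut _ x C => without x (dfv C)
  | CCutV V _ _ => dfv V
  | CPar m x y C =>
      if (x \in dfv C) || (y \in dfv C)
      then mv m :: without x (without y (dfv C)) else dfv C
  | CSubV m V _ _ => mv m :: dfv V
  | CSub m _ x C =>
      if x \in dfv C then mv m :: without x (dfv C) else dfv C
  | CDer e x C =>
      if x \in dfv C then ev e :: without x (dfv C) else dfv C
  end.

Inductive good_v : ctx -> Prop :=
  | good_hole : good_v CHole
  | good_pairl G t : good G -> good_v (CPairL G t)
  | good_pairr t G : good G -> good_v (CPairR t G)
  | good_lam x G : good G -> good_v (CLam x G)
  | good_bang G : good G -> good_v (CBang G)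
with good : ctx -> Prop :=
  | good_val V : good_v V -> good V
  | good_par m x y G : good G -> good (CPar m x y G)
  | good_sub m v x G : good G -> good (CSub m v x G)
  | good_subv m V x t : good_v V -> good (CSubV m V x t)
  | good_der e x G : good G -> good (CDer e x G)
  | good_cut v x G : good G -> x \notin dfv G -> good (CCut v x G).

Definition bad (C : ctx) : Prop := gctx C /\ ~ good C.

Definition good_step (t s : term) : Prop := exists2 P, ms_step P t s & good P.

Definition good_steps : term -> term -> Prop := clos_refl_trans term good_step.

(* Main.v *)
From mathcomp Require Import all_boot.
From Stdlib Require Import Relation_Operators.
Require Import Defs.

(** Walking down a term, keep the set [S] of those variables whose occurrence
    in the dfv of the remaining context would make it bad: a cut puts its
    variable in [S], while par, sub and der put their binders in [S] exactly
    when their head variable is there. As dfv is created only at sub values,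
    the outermost bad values are the values of cuts and the values of the subs
    whose head is in [S]. Good steps do not create bigger ones: the values
    they copy or move into a cut already are, or are inside, bad values. The
    body of the par, sub or der acted on keeps its set, because the head of
    that subterm is the cut variable, so that its binders are in [S] already
    before the step. *)

(* The invariant bounding bad values *)
Scheme term_value_ind := Induction for term Sort Prop
  with value_term_ind := Induction for value Sort Prop.
Combined Scheme term_value_mutind from term_value_ind, value_term_ind.

Definition update (x : var) (b : bool) (S : pred var) : pred var :=
  fun z => if z == x then b else S z.

(** A value that is measured is not searched further, as its subvalues are smaller. The binder of an
    abstraction leaves [S], shadowing any outer variable of that name. *)
Fixpoint bounded (N : nat) (S : pred var) (t : term) : bool :=
  match t with
  | Val v => vbounded N S v
  | Cut v x t => (value_size v <= N) && bounded N (update x true S) t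
  | Par m x y t =>
      bounded N (update y (S (mv m)) (update x (S (mv m)) S)) t
  | Sub m v x t =>
      (if S (mv m) then value_size v <= N else vbounded N S v)
      && bounded N (update x (S (mv m)) S) t
  | Der e x t => bounded N (update x (S (ev e)) S) t
  end
with vbounded (N : nat) (S : pred var) (v : value) : bool :=
  match v with
  | Var _ => true
  | Pair t s => bounded N S t && bounded N S s
  | Lam x t => bounded N (update x false S) t
  | Bang t => bounded N S t
  end.

(** Every value inside is smaller than the whole, whatever [S] is. This starts the invariant and
    covers all that is copied out of a measured value. *)
Lemma size_bounded_mut N :
  (forall t S, term_size t <= N -> bounded N S t) /\
  (forall v S, value_size v <= N -> vbounded N S v).
Proof.
apply: term_value_mutind => //=.
- move=> v _ x t IHt S le_vt; rewrite (leq_trans _ le_vt) ?IHt //.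
    by rewrite (leq_trans _ le_vt) // leqW // leq_addl.
  by rewrite leqW // leq_addr.
- by move=> m x y t IHt S /ltnW; apply: IHt.
- move=> m v IHv x t IHt S le_vt.
  have lev : value_size v <= N by rewrite (leq_trans _ le_vt) // leqW // leq_addr.
  have let_ : term_size t <= N by rewrite (leq_trans _ le_vt) // leqW // leq_addl.
  by rewrite IHt // lev IHv // if_same.
- by move=> e x t IHt S /ltnW; apply: IHt.
- move=> t IHt s IHs S le_ts.
  by rewrite IHt ?IHs //= (leq_trans _ le_ts) // leqW // ?leq_addr ?leq_addl.
- by move=> x t IHt S /ltnW; apply: IHt.
- by move=> t IHt S /ltnW; apply: IHt.
Qed.

Lemma size_bounded N S t : term_size t <= N -> bounded N S t.
Proof. exact: (size_bounded_mut N).1. Qed.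

Lemma size_vbounded N S v : value_size v <= N -> vbounded N S v.
Proof. exact: (size_bounded_mut N).2. Qed.

(** * Monotonicity in the set of variables *)

Lemma mem_without x A z : (z \in without x A) = (z != x) && (z \in A).
Proof. exact: mem_filter. Qed.

Lemma update_sub x (b b' : bool) A (S S' : pred var) :
  (b -> b') -> {in without x A, forall z, S z -> S' z} ->
  {in A, forall z, update x b S z -> update x b' S' z}.
Proof.
rewrite /update => bb' SS' z Az; case: eqP => // /eqP zx.
by apply: SS'; rewrite mem_without zx.
Qed.

(** A larger set asks for more: more sub values are measured whole, and a bound on a whole value
    covers the values inside it. Only free variables are ever looked up. *)
Lemma bounded_anti_mut N :
  (forall t (S S' : pred var), {in fv t, forall z, S z -> S' z} ->
     bounded N S' t -> bounded N S t) /\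
  (forall v (S S' : pred var), {in vfv v, forall z, S z -> S' z} ->
     vbounded N S' v -> vbounded N S v).
Proof.
have cat1 A B (S S' : pred var) : {in A ++ B, forall z, S z -> S' z} ->
    {in A, forall z, S z -> S' z}.
  by move=> SS' z Az; apply: SS'; rewrite mem_cat Az.
have cat2 A B (S S' : pred var) : {in A ++ B, forall z, S z -> S' z} ->
    {in B, forall z, S z -> S' z}.
  by move=> SS' z Bz; apply: SS'; rewrite mem_cat Bz orbT.
have hd y A (S S' : pred var) : {in y :: A, forall z, S z -> S' z} ->
    (S y -> S' y) by move=> SS'; apply: SS'; rewrite mem_head.
have tl y A (S S' : pred var) : {in y :: A, forall z, S z -> S' z} ->
    {in A, forall z, S z -> S' z}.
  by move=> SS' z Az; apply: SS'; rewrite inE Az orbT.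
apply: term_value_mutind => //=.
- move=> v IHv x t IHt S S' SS' /andP[-> /=]; apply: IHt.
  by apply: update_sub => //; apply: cat2 SS'.
- move=> m x y t IHt S S' SS'; apply: IHt.
  apply: update_sub; first exact: hd SS'.
  by apply: update_sub; [exact: hd SS' | exact: tl SS'].
- move=> m v IHv x t IHt S S' SS' /andP[Bv Bt]; apply/andP; split.
    have := hd _ _ _ _ SS'; case: (S' (mv m)) Bv => Bv.
      by case: ifP => // _ _; apply: size_vbounded.
    case: (S _) => [/(_ isT)|_] //.
    by apply: IHv Bv; apply: cat1 (tl _ _ _ _ SS').
  apply: IHt Bt; apply: update_sub; first exact: hd SS'.
  exact: cat2 (tl _ _ _ _ SS').
- move=> e x t IHt S S' SS'; apply: IHt.
  by apply: update_sub; [exact: hd SS' | exact: tl SS'].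
- move=> t IHt s IHs S S' SS' /andP[Bt Bs]; apply/andP; split.
    by apply: IHt Bt; apply: cat1 SS'.
  by apply: IHs Bs; apply: cat2 SS'.
- by move=> x t IHt S S' SS'; apply: IHt; apply: update_sub.
Qed.

Lemma bounded_anti N (S S' : pred var) t :
  {in fv t, forall z, S z -> S' z} -> bounded N S' t -> bounded N S t.
Proof. exact: (bounded_anti_mut N).1. Qed.

(** * Invariance under alpha-equivalence *)

Lemma aeq_size_mut :
  (forall t t' env, aeq_in env t t' -> term_size t = term_size t') /\
  (forall v v' env, vaeq_in env v v' -> value_size v = value_size v').
Proof.
apply: term_value_mutind => /=.
- by move=> v IHv [] //= v' env /IHv.
- by move=> v IHv x t IHt [] //= v' x' t' env /and3P[/IHv-> _ /IHt->].
- by move=> m x y t IHt [] //= m' x' y' t' env /and4P[_ _ _ /IHt->].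
- by move=> m v IHv x t IHt [] //= m' v' x' t' env /and4P[_ /IHv-> _ /IHt->].
- by move=> e x t IHt [] //= e' x' t' env /and3P[_ _ /IHt->].
- by move=> x [].
- by move=> t IHt s IHs [] //= t' s' env /andP[/IHt-> /IHs->].
- by move=> x t IHt [] //= x' t' env /andP[_ /IHt->].
- by move=> t IHt [] //= t' env /IHt->.
Qed.

(** The sets are compared along matched names only, because alpha-equivalent terms name their
    binders differently. *)
Definition env_compat (env : seq (var * var)) (S S' : pred var) : Prop :=
  forall x y, aeq_var env x y -> S x = S' y.

Lemma env_compat_update env S S' x x' b :
  env_compat env S S' ->
  env_compat ((x, x') :: env) (update x b S) (update x' b S').
Proof.
move=> SS' z z' /=; rewrite /update; case: (z == x); case: (z' == x') => //=.
exact: SS'.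
Qed.

Lemma bounded_aeq_mut N :
  (forall t t' env S S', aeq_in env t t' -> env_compat env S S' ->
     bounded N S t = bounded N S' t') /\
  (forall v v' env S S', vaeq_in env v v' -> env_compat env S S' ->
     vbounded N S v = vbounded N S' v').
Proof.
have [_ sizeE] := aeq_size_mut.
apply: term_value_mutind => /=.
- by move=> v IHv [] //= v' env S S' ? ?; apply: IHv; eassumption.
- move=> v IHv x t IHt [] //= v' x' t' env S S' /and3P[/sizeE-> _ tt'] SS'.
  by congr (_ && _); apply: IHt tt' _; apply: env_compat_update.
- move=> m x y t IHt [] //= m' x' y' t' env S S' /and4P[/[swap] _ mm' _ tt'] SS'.
  rewrite (SS' _ _ mm'); apply: IHt tt' _.
  by do 2!apply: env_compat_update.
- move=> m v IHv x t IHt [] //= m' v' x' t' env S S' /and4P[mm' vv' _ tt'] SS'.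
  rewrite (SS' _ _ mm') (sizeE _ _ _ vv') (IHv _ _ _ _ vv' SS').
  by congr (_ && _); apply: IHt tt' _; apply: env_compat_update.
- move=> e x t IHt [] //= e' x' t' env S S' /and3P[ee' _ tt'] SS'.
  by rewrite (SS' _ _ ee'); apply: IHt tt' _; apply: env_compat_update.
- by move=> x [].
- move=> t IHt s IHs [] //= t' s' env S S' /andP[tt' ss'] SS'.
  by rewrite (IHt _ _ _ _ tt' SS') (IHs _ _ _ _ ss' SS').
- move=> x t IHt [] //= x' t' env S S' /andP[_ tt'] SS'.
  by apply: IHt tt' _; apply: env_compat_update.
- by move=> t IHt [] //= t' env S S'; apply: IHt.
Qed.

Lemma bounded_aeq N S t t' : aeq t t' -> bounded N S t = bounded N S t'.
Proof.
move=> tt'; apply: (bounded_aeq_mut N).1 tt' _ => x y /=.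
by move=> /eqP->.
Qed.

(** * Renaming of multiplicative variables *)

Lemma update_rename n m x (b b' : bool) (S S' : pred var) :
  x != mv m -> x != mv n -> (b' -> b) ->
  (forall z, S' (rename_var n m z) -> S z) ->
  forall z, update x b' S' (rename_var n m z) -> update x b S z.
Proof.
move=> xm xn bb' SS' z; have [->|zx] := eqVneq z x.
  by rewrite /rename_var (negPf xm) /update eqxx.
rewrite /update (negPf zx); case: eqP => [|_ /SS' //].
rewrite /rename_var; case: eqP => _ zx'; last by rewrite zx' eqxx in zx.
by rewrite zx' eqxx in xn.
Qed.

Lemma rename_var_name n m k : rename_var n m (mv k) = mv (rename_name n m k).
Proof.
rewrite /rename_var /rename_name (inj_eq (@inl_inj _ _)).
by case: eqP.
Qed.

(** An implication relates the sets, since the renamed term may be judged in a smaller one. Sizes go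
    through the same induction because measured values are renamed too. *)
Lemma bounded_rename_mut N n m :
  (forall t, term_size (rename n m t) = term_size t /\
     forall S S' : pred var, mv m \notin bv t -> mv n \notin bv t ->
     (forall z, S' (rename_var n m z) -> S z) ->
     bounded N S t -> bounded N S' (rename n m t)) /\
  (forall v, value_size (vrename n m v) = value_size v /\
     forall S S' : pred var, mv m \notin vbv v -> mv n \notin vbv v ->
     (forall z, S' (rename_var n m z) -> S z) ->
     vbounded N S v -> vbounded N S' (vrename n m v)).
Proof.
apply: term_value_mutind => //=.
- move=> v [sv IHv] x t [st IHt]; rewrite sv fun_if st if_same; split=> // S S'.
  rewrite !mem_cat !inE !negb_or ![mv _ == x]eq_sym.
  move=> /and3P[mv_ xm mt] /and3P[nv xn nt] SS' /andP[-> /=].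
  by rewrite (negPf xm); apply: IHt => //; apply: update_rename.
- move=> k x y t [st IHt]; rewrite fun_if st if_same; split=> // S S'.
  rewrite !inE !negb_or ![mv _ == x]eq_sym ![mv _ == y]eq_sym.
  move=> /and3P[xm ym mt] /and3P[xn yn nt] SS'.
  rewrite (negPf xm) (negPf ym) /=; apply: IHt => //.
  have kk : S' (mv (rename_name n m k)) -> S (mv k).
    by rewrite -rename_var_name; apply: SS'.
  by do 2!apply: update_rename => //.
- move=> k v [sv IHv] x t [st IHt]; rewrite sv fun_if st if_same; split=> // S S'.
  rewrite !mem_cat !inE !negb_or ![mv _ == x]eq_sym.
  move=> /and3P[mv_ xm mt] /and3P[nv xn nt] SS' /andP[Bv Bt].
  have kk : S' (mv (rename_name n m k)) -> S (mv k).
    by rewrite -rename_var_name; apply: SS'.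
  rewrite (negPf xm); apply/andP; split; last first.
    by apply: IHt Bt => //; apply: update_rename.
  case: (S (mv k)) kk Bv => kk Bv.
    by case: ifP => // _; apply: size_vbounded; rewrite sv.
  by case: ifP => [/kk //|_]; apply: IHv Bv.
- move=> e x t [st IHt]; rewrite fun_if st if_same; split=> // S S'.
  rewrite !inE !negb_or ![mv _ == x]eq_sym.
  move=> /andP[xm mt] /andP[xn nt] SS'.
  rewrite (negPf xm); apply: IHt => //; apply: update_rename => //.
  exact: (SS' (ev e)).
- move=> t [st IHt] s [ss IHs]; rewrite st ss; split=> // S S'.
  rewrite !mem_cat !negb_or => /andP[mt ms] /andP[nt ns] SS' /andP[Bt Bs].
  by rewrite (IHt S) ?(IHs S).
- move=> x t [st IHt]; rewrite fun_if st if_same; split=> // S S'.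
  rewrite !inE !negb_or ![mv _ == x]eq_sym.
  move=> /andP[xm mt] /andP[xn nt] SS'.
  by rewrite (negPf xm); apply: IHt => //; apply: update_rename.
- by move=> t [st IHt]; rewrite st.
Qed.

Lemma bounded_rename N (S S' : pred var) n m t :
  mv m \notin bv t -> mv n \notin bv t ->
  (forall z, S' (rename_var n m z) -> S z) ->
  bounded N S t -> bounded N S' (rename n m t).
Proof. exact: ((bounded_rename_mut N n m).1 t).2. Qed.

(** * Goodness relative to a set of variables *)

Definition value_shaped (C : ctx) : bool :=
  match C with
  | CHole | CPairL _ _ | CPairR _ _ | CLam _ _ | CBang _ => true
  | _ => false
  end.

(** Goodness is tested from the root down with the set carried by [bounded], in place of dfv
    computed from the hole up. For well-shaped contexts the test amounts to goodness together with
    dfv disjoint from [S]. *)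
Fixpoint good_in (S : pred var) (C : ctx) : bool :=
  match C with
  | CHole => true
  | CPairL C _ | CPairR _ C | CBang C => good_in S C
  | CLam x C => good_in (update x false S) C
  | CCutV _ _ _ => false
  | CSubV m V _ _ => [&& ~~ S (mv m), value_shaped V & good_in S V]
  | CCut _ x C => good_in (update x true S) C
  | CPar m x y C => good_in (update y (S (mv m)) (update x (S (mv m)) S)) C
  | CSub m _ x C => good_in (update x (S (mv m)) S) C
  | CDer e x C => good_in (update x (S (ev e)) S) C
  end.

Fixpoint scope (S : pred var) (C : ctx) : pred var :=
  match C with
  | CHole => S
  | CPairL C _ | CPairR _ C | CBang C | CCutV C _ _ | CSubV _ C _ _ => scope S C
  | CLam x C => scope (update x false S) C
  | CCut _ x C => scope (update x true S) C
  | CPar m x y C => scope (update y (S (mv m)) (update x (S (mv m)) S)) C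
  | CSub m _ x C => scope (update x (S (mv m)) S) C
  | CDer e x C => scope (update x (S (ev e)) S) C
  end.

Definition disjoint_dfv (S : pred var) (C : ctx) : Prop :=
  forall z, S z -> z \notin dfv C.

Lemma disjoint_update x (b : bool) A (S : pred var) :
  (forall z, S z -> z \notin without x A) -> (b -> x \notin A) ->
  forall z, update x b S z -> z \notin A.
Proof.
move=> SA bA z; rewrite /update; case: eqP => [->//|/eqP zx /SA].
by rewrite mem_without zx.
Qed.

Scheme good_good_v_ind := Minimality for good Sort Prop
  with good_v_good_ind := Minimality for good_v Sort Prop.
Combined Scheme good_mutind from good_good_v_ind, good_v_good_ind.

(** If a binder is in the dfv of the body, then [m] is in that of the whole, hence outside [S], and
    the binders stay outside too; otherwise adding them is harmless. *)
Lemma disjoint_dfv_par S m x y C : disjoint_dfv S (CPar m x y C) ->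
  disjoint_dfv (update y (S (mv m)) (update x (S (mv m)) S)) C.
Proof.
rewrite /disjoint_dfv /= => dis; case: ifP dis => [_|/negbT/norP[xC yC]] dis.
  have Sm : S (mv m) = false by apply/negP => /dis; rewrite mem_head.
  apply: disjoint_update; rewrite Sm //.
  apply: disjoint_update => // z /dis.
  by rewrite inE negb_or => /andP[].
apply: disjoint_update => //; apply: disjoint_update => [z Sz|_].
  by rewrite !mem_without (negPf (dis z Sz)) !andbF.
by rewrite mem_without (negPf xC) andbF.
Qed.

Lemma disjoint_dfv_head (S : pred var) m x C :
  (forall z, S z -> z \notin
     (if x \in dfv C then m :: without x (dfv C) else dfv C)) ->
  disjoint_dfv (update x (S m) S) C.
Proof.
move=> dis; case: ifP dis => [_|/negbT xC] dis.
  have Sm : S m = false by apply/negP => /dis; rewrite mem_head.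
  apply: disjoint_update => [z /dis|]; last by rewrite Sm.
  by rewrite inE negb_or => /andP[].
by apply: disjoint_update => // z /dis zC; rewrite mem_without (negPf zC) andbF.
Qed.

Lemma good_good_in_mut :
  (forall C, good C -> forall S, disjoint_dfv S C -> good_in S C) /\
  (forall C, good_v C -> value_shaped C /\ forall S, disjoint_dfv S C -> good_in S C).
Proof.
apply: good_mutind => //=.
- by move=> V _ [_].
- by move=> m x y G _ IH S /disjoint_dfv_par; apply: IH.
- by move=> m v x G _ IH S /disjoint_dfv_head; apply: IH.
- move=> m V x t _ [-> IH] S dis; apply/and3P; split=> //.
    by apply/negP => /dis; rewrite mem_head.
  by apply: IH => z /dis; rewrite inE negb_or => /andP[].
- by move=> e x G _ IH S /disjoint_dfv_head; apply: IH.
- by move=> v x G _ IH xG S dis; apply: IH; apply: disjoint_update.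
- by move=> x G _ IH; split=> // S dis; apply: IH; apply: disjoint_update.
Qed.

Lemma good_good_in C : good C -> good_in pred0 C.
Proof. by move=> gC; apply: good_good_in_mut.1. Qed.

(* All that is needed of [gctx]: plugging a value triggers no extrusion. *)
Fixpoint well_shaped (C : ctx) : bool :=
  match C with
  | CHole => true
  | CPairL C _ | CPairR _ C | CBang C | CLam _ C
  | CCut _ _ C | CPar _ _ _ C | CSub _ _ _ C | CDer _ _ C => well_shaped C
  | CCutV V _ _ | CSubV _ V _ _ => value_shaped V && well_shaped V
  end.

Scheme gctx_vctx_ind := Minimality for gctx Sort Prop
  with vctx_gctx_ind := Minimality for vctx Sort Prop.
Combined Scheme gctx_mutind from gctx_vctx_ind, vctx_gctx_ind.

Lemma gctx_well_shaped C : gctx C -> well_shaped C.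
Proof.
suff : (forall C, gctx C -> well_shaped C) /\
  (forall V, vctx V -> value_shaped V && well_shaped V) by case=> + _; apply.
apply: gctx_mutind => //= [V _ /andP[] //|L D _ wD].
by elim: L.
Qed.

Lemma good_v_of_good C : value_shaped C -> good C -> good_v C.
Proof. by move=> + gC; case: gC. Qed.

Lemma update_disjoint x (b : bool) A (S : pred var) :
  (forall z, update x b S z -> z \notin A) ->
  (forall z, S z -> z \notin without x A) /\ (b -> x \notin A).
Proof.
rewrite /update => dis; split=> [z Sz|bT]; last by apply: dis; rewrite eqxx.
rewrite mem_without negb_and negbK; case: eqP (dis z) => //= _; exact.
Qed.

Lemma update_disjoint_head (S : pred var) m x A :
  (forall z, update x (S m) S z -> z \notin A) ->
  forall z, S z -> z \notin (if x \in A then m :: without x A else A).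
Proof.
move=> /update_disjoint[dis xA] z Sz; have := dis _ Sz; case: ifP => [Ax|/negbT nAx].
  by move=> zA; rewrite inE negb_or zA andbT; apply: contraL Ax => /eqP zm; apply: xA; rewrite -zm.
by rewrite mem_without negb_and negbK => /orP[/eqP->|].
Qed.

(** This converse of [good_good_in] turns badness into failure of the test. *)
Lemma good_in_good C S : well_shaped C -> good_in S C -> good C /\ disjoint_dfv S C.
Proof.
elim: C S => /=.
- by move=> S _ _; split=> //; do 2!constructor.
- by move=> C IH s S wC /IH[]// gC dC; split=> //; do 2!constructor.
- by move=> t C IH S wC /IH[]// gC dC; split=> //; do 2!constructor.
- move=> x C IH S wC /IH[]// gC /update_disjoint[dC _].
  by split=> //; do 2!constructor.
- by move=> C IH S wC /IH[]// gC dC; split=> //; do 2!constructor.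
- by [].
- move=> m V IH x t S /andP[shV wV] /and3P[Sm _ /IH[]// gV dV]; split.
    by constructor; apply: good_v_of_good.
  move=> z Sz /=; rewrite inE negb_or dV // andbT.
  by apply: contraNneq Sm => <-.
- move=> v x C IH S wC /IH[]// gC /update_disjoint[dC xC].
  by split=> //; constructor=> //; apply: xC.
- move=> m x y C IH S wC /IH[]// gC /update_disjoint[dC yC].
  split; first by constructor.
  have [dC' xC] := update_disjoint _ _ _ _ dC.
  move=> z Sz /=; have := dC' _ Sz.
  (* If the two binders coincide, the update at [y] overrides the one at [x], and [yC] must be
     used. *)
  have Sm_x : S (mv m) -> x \notin dfv C.
    move=> Sm; have := xC Sm; rewrite mem_without negb_and negbK.
    by case/orP=> // /eqP->; apply: yC.
  case: ifP => [|/negbT/norP[xnC ynC]].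
    move=> xyC; rewrite inE negb_or => ->; rewrite andbT.
    by apply: contraTneq xyC => zm; rewrite zm in Sz; rewrite negb_or Sm_x ?yC.
  by rewrite !mem_without !negb_and !negbK => /or3P[/eqP->|/eqP->|].
- move=> m v x C IH S wC /IH[]// gC dC; split; first by constructor.
  exact: update_disjoint_head.
- move=> e x C IH S wC /IH[]// gC dC; split; first by constructor.
  exact: update_disjoint_head.
Qed.

(** * Bad values obey the bound *)

Lemma plug_value_shaped V t : value_shaped V -> (V = CHole -> is_val t) ->
  exists v, plug V t = Val v.
Proof.
case: V => //=; try by move=> *; eexists.
by move=> _ /(_ erefl); case: t => // v; exists v.
Qed.

Lemma size_lmap f t : (forall v, value_size v <= term_size (f v)) ->
  term_size t <= term_size (lmap f t).
Proof.
by move=> fs; elim: t => //= [v x t IH|m v x t IH]; rewrite ltnS leq_add2l.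
Qed.

Lemma size_plug C t : term_size t <= term_size (plug C t).
Proof.
elim: C => //=.
- by move=> C IH s; rewrite (leq_trans IH) // leqW // leq_addr.
- by move=> s C IH; rewrite (leq_trans IH) // leqW // leq_addl.
- by move=> _ C IH; rewrite leqW.
- by move=> C IH; rewrite leqW.
- by move=> C IH x s; rewrite (leq_trans IH) // size_lmap // => v; rewrite leqW // leq_addr.
- by move=> m C IH x s; rewrite (leq_trans IH) // size_lmap // => v; rewrite leqW // leq_addr.
- by move=> v _ C IH; rewrite (leq_trans IH) // leqW // leq_addl.
- by move=> _ _ _ C IH; rewrite leqW.
- by move=> _ v _ C IH; rewrite (leq_trans IH) // leqW // leq_addl.
- by move=> _ _ C IH; rewrite leqW.
Qed.

(** On the way to the hole, goodness can only fail by entering the value of a cut, or of a sub with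
    head in the set; the invariant measures that value, which contains [v]. *)
Lemma bad_value_bounded N S C v : well_shaped C -> ~~ good_in S C ->
  bounded N S (plug C (Val v)) -> value_size v <= N.
Proof.
elim: C S => //=.
- by move=> C IH s S wC gC /andP[/IH-> //].
- by move=> t C IH S wC gC /andP[_ /IH->].
- by move=> x C IH S wC gC /IH->.
- move=> V _ x s S /andP[shV wV] _.
  have [//|w Ew] := plug_value_shaped _ (Val v) shV.
  have /= := size_plug V (Val v); rewrite Ew /= => le_vw /andP[le_wN _].
  exact: leq_trans le_vw le_wN.
- move=> m V IH x s S /andP[shV wV]; rewrite shV /=.
  have [//|w Ew] := plug_value_shaped _ (Val v) shV.
  have /= := size_plug V (Val v); have := IH S wV; rewrite Ew /=.
  case: (S (mv m)) => /= [_ le_vw _|IH' _ gV] /andP[Bw _].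
    exact: leq_trans le_vw Bw.
  exact: IH' gV Bw.
- by move=> w x C IH S wC gC /andP[_ /IH->].
- by move=> m x y C IH S wC gC /IH->.
- by move=> m w x C IH S wC gC /andP[_ /IH->].
- by move=> e x C IH S wC gC /IH->.
Qed.

(** * Replacement at the hole of a good context *)

Lemma value_shaped_comp C D : value_shaped (comp C D) -> value_shaped C.
Proof. by case: C. Qed.

Lemma good_in_comp S C D : good_in S (comp C D) ->
  good_in S C /\ good_in (scope S C) D.
Proof.
elim: C S => //=; try by move=> *; eauto.
by move=> m C IH x t S /and3P[-> /value_shaped_comp-> /IH[-> ->]].
Qed.

Lemma actual_plug_value m V x t r : value_shaped V -> actual (CSubV m V x t) r ->
  actual V r /\ exists v, plug V r = Val v.
Proof.
move=> shV act; split; first by case: V act {shV}.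
by apply: plug_value_shaped => // EV; move: act; rewrite EV.
Qed.

(** A good context enters no measured value, so the replacement changes no measured size. Values
    must stay values, as otherwise a sub around the hole would be extruded. *)
Lemma bounded_plug N S C r r' : good_in S C -> actual C r ->
  (is_val r -> is_val r') ->
  (bounded N (scope S C) r -> bounded N (scope S C) r') ->
  bounded N S (plug C r) -> bounded N S (plug C r').
Proof.
move=> + + val_rr'; elim: C S => //=.
- by move=> C IH s S gC aC rr' /andP[BC ->]; rewrite (IH S).
- by move=> t C IH S gC aC rr' /andP[-> BC]; rewrite (IH S).
- by move=> x C IH S gC aC rr'; apply: IH.
- move=> m V IH x t S /and3P[nSm shV gV] act rr'.
  have [aV [v Ev]] := actual_plug_value _ _ _ _ _ shV act.
  have [|v' Ev'] := plug_value_shaped V r' shV.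
    by move=> EV; apply: val_rr'; move: act; rewrite EV.
  have := IH S gV aV rr'; rewrite Ev Ev' /= (negPf nSm) => BB /andP[/BB-> ->] //.
- by move=> v x C IH S gC aC rr' /andP[-> /IH->].
- by move=> m x y C IH S gC aC rr'; apply: IH.
- by move=> m v x C IH S gC aC rr' /andP[-> /IH->].
- by move=> e x C IH S gC aC rr'; apply: IH.
Qed.

(** Only a binder of the same name could remove [x] from the set. Thus the cut variable is still
    there at the occurrence acted on. *)
Lemma mem_scope (S : pred var) C x : S x -> x \notin hole_bv C -> scope S C x.
Proof.
have upd y b (S' : pred var) : S' x -> x != y -> update y b S' x.
  by rewrite /update => S'x /negPf->.
elim: C S => //= [y C IH|v y C IH|m y z C IH|m v y C IH|e y C IH] S Sx;
  rewrite !inE !negb_or.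
- by case/andP=> xy; apply: IH; apply: upd.
- by case/andP=> xy; apply: IH; apply: upd.
- by case/and3P=> xy xz; apply: IH; do 2!apply: (upd) => //.
- by case/andP=> xy; apply: IH; apply: upd.
- by case/andP=> xy; apply: IH; apply: upd.
Qed.

(** * Barendregt's convention on subterms *)

(** Plugging may capture, turning a free variable of [t] into a bound one; the disjunction absorbs
    this. *)
Lemma mem_vars_plug S C t z : good_in S C -> actual C t ->
  (z \in fv t) || (z \in bv t) ->
  (z \in fv (plug C t)) || (z \in bv (plug C t)).
Proof.
move=> + + zt; elim: C S => /=.
- by [].
- by move=> C IH s S gC aC; rewrite !mem_cat orbACA (IH S).
- by move=> s C IH S gC aC; rewrite !mem_cat orbACA (IH S) ?orbT.
- move=> x C IH S gC aC; rewrite mem_without inE.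
  by case: (z == x); have /orP[->|->] := IH _ gC aC; rewrite ?orbT.
- by move=> C IH S gC aC; apply: IH gC aC.
- by [].
- move=> m V IH x s S /and3P[_ shV gV] act.
  have [aV [v Ev]] := actual_plug_value _ _ _ _ _ shV act.
  have := IH S gV aV; rewrite Ev /= inE !mem_cat.
  by case/orP=> ->; rewrite ?orbT.
- move=> v x C IH S gC aC; rewrite !mem_cat mem_without inE.
  by case: (z == x); have /orP[->|->] := IH _ gC aC; rewrite ?orbT.
- move=> m x y C IH S gC aC; rewrite !inE !mem_without.
  by case: (z == x); case: (z == y); have /orP[->|->] := IH _ gC aC; rewrite ?orbT.
- move=> m v x C IH S gC aC; rewrite !inE !mem_cat mem_without inE.
  by case: (z == x); have /orP[->|->] := IH _ gC aC; rewrite ?orbT.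
- move=> e x C IH S gC aC; rewrite !inE mem_without.
  by case: (z == x); have /orP[->|->] := IH _ gC aC; rewrite ?orbT.
Qed.

(** [A] and [B] are the free and bound names of a term, [A'] and [B'] those of a subterm: a name
    free in the subterm is free in the whole or bound outside the subterm. *)
Lemma fresh_sub (A A' B B' : seq var) : subseq B' B ->
  (uniq B -> {in A', forall z, (z \in A) || (z \in B) && (z \notin B')}) ->
  uniq B && ~~ has (mem A) B -> uniq B' && ~~ has (mem A') B'.
Proof.
move=> BB AA /andP[uB /hasPn nAB]; rewrite (subseq_uniq BB uB) /=.
apply/hasPn => z zB'; apply/negP => /(AA uB); rewrite zB' andbF orbF.
exact/negP/nAB/(mem_subseq BB).
Qed.

Lemma fresh_sub_binder x (A A' B B' : seq var) :
  {subset without x A' <= A} ->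
  uniq (B ++ x :: B') && ~~ has (mem A) (B ++ x :: B') ->
  uniq B' && ~~ has (mem A') B'.
Proof.
move=> AA; apply: fresh_sub.
  by apply: subseq_trans (suffix_subseq _ _); apply: subseq_cons.
rewrite cat_uniq /= => /and4P[_ _ xB' _] z zA'.
have [->|zx] := eqVneq z x; first by rewrite mem_cat mem_head orbT xB' orbT.
by rewrite AA // mem_without zx.
Qed.

Lemma barendregt_plug S C r : good_in S C -> actual C r ->
  barendregt (plug C r) -> barendregt r.
Proof.
rewrite /barendregt; elim: C S => //=.
- move=> C IH s S gC aC fr; apply: IH gC aC _; apply: fresh_sub fr => [|_ z zC].
    exact: prefix_subseq.
  by rewrite mem_cat zC.
- move=> s C IH S gC aC fr; apply: IH gC aC _; apply: fresh_sub fr => [|_ z zC].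
    exact: suffix_subseq.
  by rewrite mem_cat zC orbT.
- move=> x C IH S gC aC fr; apply: IH gC aC _.
  exact: (@fresh_sub_binder x _ _ [::] _ _ fr).
- move=> m V IH x s S /and3P[_ shV gV] act fr.
  have [aV [v Ev]] := actual_plug_value _ _ _ _ _ shV act.
  apply: IH gV aV _; move: fr; rewrite Ev /=; apply: fresh_sub => [|_ z zv].
    exact: prefix_subseq.
  by rewrite inE mem_cat zv orbT.
- move=> v x C IH S gC aC fr; apply: IH gC aC _; apply: fresh_sub_binder fr.
  by move=> z zC; rewrite mem_cat zC orbT.
- move=> m x y C IH S gC aC fr; apply: IH gC aC _.
  (* The binders are removed one at a time, passing through the free variables with only [y] taken
     out. *)
  apply: (@fresh_sub_binder y (without y (fv (plug C r))) _ [::]) => //.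
  apply: (@fresh_sub_binder x _ _ [::]) fr.
  by move=> z zC; rewrite inE zC orbT.
- move=> m v x C IH S gC aC fr; apply: IH gC aC _; apply: fresh_sub_binder fr.
  by move=> z zC; rewrite inE mem_cat zC !orbT.
- move=> e x C IH S gC aC fr; apply: IH gC aC _.
  apply: (@fresh_sub_binder x _ _ [::]) fr.
  by move=> z zC; rewrite inE zC orbT.
Qed.

(** By the convention, left contexts taken out of the cut value capture nothing in the subterm acted
    on. *)
Lemma barendregt_cut_fresh S x v C t : good_in S C -> actual C t ->
  barendregt (Cut v x (plug C t)) ->
  forall z, (z \in fv t) || (z \in bv t) -> z \notin vbv v.
Proof.
move=> gC aC /andP[/= uB /hasPn nfv] z /(mem_vars_plug _ _ _ _ gC aC) zt.
apply/negP => zv; move: uB; rewrite cat_uniq => /and3P[_ /hasPn nB _].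
have nx : z != x.
  by apply: contraTneq zv => ->; apply: nB; rewrite mem_head.
case/orP: zt => zt.
  have := nfv z; rewrite mem_cat zv => /(_ isT) /negP[].
  by rewrite /= mem_cat mem_without nx zt orbT.
by have /= := nB z; rewrite inE zt orbT => /(_ isT) /negP.
Qed.

(** * Left contexts released by a step *)

(* [A] is the set of the free variables of the body that ends up under [L],
   which [L] does not bind. *)
Lemma bounded_lplug N (S : pred var) L v u (A : seq var) :
  term_size (lplug L (Val v)) <= N ->
  {in A, forall z, z \notin bv (lplug L (Val v))} ->
  (forall S' : pred var, {in A, S' =1 S} -> bounded N S' u) ->
  bounded N S (lplug L u).
Proof.
have upd x b (S1 S2 : pred var) : {in A, forall z, z != x} ->
    {in A, S2 =1 update x b S1} -> {in A, S2 =1 S1}.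
  by move=> Ax eqS z Az; rewrite eqS // /update (negPf (Ax _ Az)).
have hd x B : {in A, forall z, z \notin x :: B} -> {in A, forall z, z != x}.
  by move=> AB z /AB; rewrite inE => /norP[].
have tl x B : {in A, forall z, z \notin x :: B} -> {in A, forall z, z \notin B}.
  by move=> AB z /AB; rewrite inE => /norP[].
have sfx B1 B2 : {in A, forall z, z \notin B1 ++ B2} -> {in A, forall z, z \notin B2}.
  by move=> AB z /AB; rewrite mem_cat => /norP[].
elim: L S => /= [S _ _|w x L IH S le_N|m x y L IH S le_N|m w x L IH S le_N|e x L IH S le_N].
- by apply.
- move=> /sfx AB Bu; rewrite (leq_trans _ le_N) ?leqW ?leq_addr //=.
  apply: IH (tl _ _ AB) _ => [|S' eqS]; first by rewrite (leq_trans _ le_N) // leqW ?leq_addl.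
  by apply: Bu; apply: upd (hd _ _ AB) eqS.
- move=> AB Bu.
  apply: IH (tl _ _ (tl _ _ AB)) _ => [|S' eqS]; first exact: ltnW.
  by apply: Bu; apply: upd (hd _ _ AB) (upd _ _ _ _ (hd _ _ (tl _ _ AB)) eqS).
- move=> /sfx AB Bu; have le_w : value_size w <= N.
    by rewrite (leq_trans _ le_N) ?leqW ?leq_addr.
  (* The size bound settles the sub value whether or not its head is in the set. *)
  rewrite le_w size_vbounded // if_same /=.
  apply: IH (tl _ _ AB) _ => [|S' eqS]; first by rewrite (leq_trans _ le_N) // leqW ?leq_addl.
  by apply: Bu; apply: upd (hd _ _ AB) eqS.
- move=> AB Bu; apply: IH (tl _ _ AB) _ => [|S' eqS]; first exact: ltnW.
  by apply: Bu; apply: upd (hd _ _ AB) eqS.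
Qed.

Lemma size_lplug L t : term_size t <= term_size (lplug L t).
Proof.
elim: L => //= [w x L|m x y L|m w x L|e x L] IH; rewrite (leq_trans IH) // leqW //;
exact: leq_addl.
Qed.

(** Apart from [x], [S0] is the set in which [t] was judged before the step, and [S] the one where
    it is now placed. The value of the new cut is part of a term of size at most [N]. *)
Lemma bounded_lplug_cut N (S S0 : pred var) L v x t :
  term_size (lplug L (Val v)) <= N ->
  {in fv t, forall z, z \notin bv (lplug L (Val v))} ->
  {in fv t, forall z, S z -> S0 z} ->
  bounded N (update x true S0) t -> bounded N S (lplug L (Cut v x t)).
Proof.
move=> le_N AB SS0 Bt; apply: bounded_lplug (le_N) AB _ => S' eqS /=.
rewrite (leq_trans (size_lplug L (Val v)) le_N) /=.
apply: bounded_anti Bt => z zt; rewrite /update; case: eqP => // _.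
by rewrite eqS //; apply: SS0.
Qed.

(** * Preservation by good steps *)

(** The fired cut has its value measured, so whatever is copied or released from it has size at most
    [N]. A par, sub or der acted on has its head in the set, so its binders are there too, and the
    value of a sub is measured, as the new cuts require. *)
Lemma bounded_root N S R r r' : root R r r' -> good_in S R -> barendregt r ->
  bounded N S r -> bounded N S r'.
Proof.
(* For the rules in which the cut disappears, its variable leaves the set. *)
have anti x t : bounded N (update x true S) t -> bounded N S t.
  by apply: bounded_anti => z _ Sz; rewrite /update; case: eqP.
have hole x D : x \notin hole_bv D -> scope (update x true S) D x.
  by apply: mem_scope; rewrite /update eqxx.
case=> /=.
- move=> v m M _ _ mM _ gM _ /andP[le_v BM]; apply: anti.
  apply: bounded_plug gM _ _ _ BM; rewrite /actual ?implybT //= => _.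
  exact: size_vbounded.
- move=> n m t D tx _ _ _ _ _ _ /andP[ub /hasPn nf] /andP[_ Bt].
  have /andP[mt _] : (mv m \notin bv t) && uniq (bv t) by [].
  have nt : mv n \notin bv t.
    by apply/negP => nt; have := nf (mv n); rewrite /= !inE nt eqxx orbT => /(_ isT).
  (* As [m] is in the set under the cut, it may become [n] whether or not [n] is in [S]. *)
  apply: bounded_rename Bt => // z; rewrite /update /rename_var.
  by case: eqP.
- move=> s u L v L' v' m M x y t _ mM aM -> -> gM bar /andP[le_N BM].
  have AB : {in fv t, forall z, z \notin vbv (Pair (lplug L (Val v)) (lplug L' (Val v')))}.
    move=> z zt; apply: (barendregt_cut_fresh _ _ _ _ _ gM aM bar) => /=.
    by rewrite !inE !mem_without zt; case: (z == x); case: (z == y); rewrite ?orbT.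
  have le_s : term_size (lplug L (Val v)) <= N.
    by rewrite (leq_trans _ le_N) // leqW // leq_addr.
  have le_u : term_size (lplug L' (Val v')) <= N.
    by rewrite (leq_trans _ le_N) // leqW // leq_addl.
  apply: anti; apply: bounded_plug gM aM _ _ BM => //=.
  (* Under [L] the set may change outside [fv t]; [L'] and [v'] are bounded by size alone, so
     agreement on [fv t] is enough. *)
  rewrite hole // => Bt; apply: (bounded_lplug _ _ _ _ _ (fv t)) (le_s) _ _.
    by move=> z /AB; rewrite mem_cat => /norP[].
  move=> S' eqS /=; rewrite (leq_trans (size_lplug L (Val v)) le_s) /=.
  apply: bounded_lplug_cut le_u _ _ Bt => z zt.
    by have := AB z zt; rewrite mem_cat => /norP[].
  by rewrite /update; case: eqP => // _; rewrite eqS.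
- move=> y s L v' m M v x t _ mM aM -> gM bar /andP[le_N BM].
  have AB : {in fv t, forall z, z \notin vbv (Lam y (lplug L (Val v')))}.
    move=> z zt; apply: (barendregt_cut_fresh _ _ _ _ _ gM aM bar) => /=.
    by rewrite !(inE, mem_cat) mem_without zt; case: (z == x); rewrite ?orbT.
  apply: anti; apply: bounded_plug gM aM _ _ BM => //=.
  (* The head is in the set, so the value of the sub was already measured, as its new cut requires.
     The variable [y] is not free in [t], so its entering the set is harmless. *)
  rewrite hole // => /andP[-> Bt] /=.
  apply: bounded_lplug_cut (ltnW le_N) _ _ Bt => z /AB; rewrite inE => /norP[zy //].
  by rewrite /update (negPf zy).
- move=> v e C _ _ eC _ gC _ /andP[le_v BC]; rewrite le_v.
  apply: bounded_plug gC _ _ _ BC; rewrite /actual ?implybT //= => _.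
  exact: size_vbounded.
- move=> f e C x t _ eC aC gC _ /andP[le_v BC]; rewrite le_v.
  apply: bounded_plug gC aC _ _ BC => //=.
  (* The binder [x] was in the set because of [e]; now it is so only if [f] is, and the set can only
     shrink. *)
  rewrite hole //; apply: bounded_anti => z _.
  by rewrite /update; case: eqP.
- move=> s L v e C x t _ eC aC -> gC bar /andP[le_N BC]; rewrite le_N.
  have AB : {in fv t, forall z, z \notin vbv (Bang (lplug L (Val v)))}.
    move=> z zt; apply: (barendregt_cut_fresh _ _ _ _ _ gC aC bar) => /=.
    by rewrite !inE mem_without zt; case: (z == x); rewrite ?orbT.
  apply: bounded_plug gC aC _ _ BC => //=.
  rewrite hole // => Bt.
  by apply: bounded_lplug_cut (ltnW le_N) _ _ Bt.
- by move=> v e t _ _ _ _ /andP[_ /anti].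
Qed.

Lemma bounded_good_step N t s :
  good_step t s -> bounded N pred0 t -> bounded N pred0 s.
Proof.
case=> P [C R r r' _ rt aC -> tr bar rs] /good_good_in/good_in_comp[gC gR].
rewrite (bounded_aeq _ _ _ _ tr) -(bounded_aeq _ _ _ _ rs).
(* A redex is a cut, never a value. *)
apply: bounded_plug (gC) (aC) _ _; first by case: rt.
by apply: bounded_root rt gR _; apply: barendregt_plug gC aC bar.
Qed.

(* A bad value of s is given up to alpha-equivalence of s. *)
Theorem theorem11p9 (t s : term) (C : ctx) (v : value) :
  good_steps t s -> aeq s (plug C (Val v)) -> bad C -> value_size v <= term_size t.
Proof.
move=> ts sC [gC badC]; have wC := gctx_well_shaped _ gC.
have : bounded (term_size t) pred0 t by apply: size_bounded.
have {ts} : bounded (term_size t) pred0 t -> bounded (term_size t) pred0 s.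
  (* The bound is generalised, so that it stays fixed while the term changes along the reduction. *)
  elim: ts (term_size t) => [t1 t2 st|t1|t1 t2 t3 _ IH1 _ IH2] N //.
    exact: bounded_good_step st.
  by move/IH1/IH2.
move=> /[apply]; rewrite (bounded_aeq _ _ _ _ sC).
(* Passing the test with the empty set would make [C] good. *)
apply: bad_value_bounded (wC) _; apply/negP => /(good_in_good _ _ wC)[].
by move/badC.
Qed.
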